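(* Let $M\subset\bigoplus_{i=1}^rA[-\delta_i]$ be a graded right $A$-submodule and $M'=L(M)\subset\bigoplus_iS[-\delta_i]$. Let $\{g_j\}$ be a set of homogeneous elements of $M$ and $g'_j=\iota(g_j)$. Then $\{g_j\}$ is a basis (resp. minimal basis) of $M$ if and only if $\{g'_j\}$ is a basis (resp. minimal basis) of $M'$. In particular $b_d(M)=b_d(M')$ for all $d\ge0$.
   Context: Let $\mathbb K$ be a field, $F=\mathbb K\langle x_1,\dots,x_n\rangle$ with standard grading, $I\subset F$ a graded two-sided ideal, $A=F/I$, $A[-\delta]_d=A_{d-\delta}$, $\bigoplus_{i=1}^rA[-\delta_i]$ the graded free right $A$-module with basis $e_i$ of degree $\delta_i$. A basis of a graded module is a homogeneous generating set; minimal if no element lies in the submodule generated by the others; $b_d$ counts the degree-$d$ elements of a minimal homogeneous basis. Let $P=\mathbb K[x_{ij}\mid1\le i\le n,j\ge1]$ (commutative, $\deg x_{ij}=1$), $Q$ the ideal generated by all $x_{ij}x_{kj}$, $R=P/Q$, $\sigma:x_{ij}\mapsto x_{i,j+1}$, $\iota:F\to R$ the $\mathbb K$-linear map $x_{i_1}\cdots x_{i_d}\mapsto x_{i_11}\cdots x_{i_dd}$, $J$ the ideal generated by $\bigcup_{k\ge0}\sigma^k(\iota(I))$, $S=R/J$ (with induced $\sigma$ and induced injective graded linear $\iota:A\to S$). $\bigoplus_iS[-\delta_i]$ is the graded free $S$-module with basis $e'_i$ of degree $\delta_i$; $\iota:\bigoplus_iA[-\delta_i]\to\bigoplus_iS[-\delta_i]$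 is $e_if\mapsto e'_i\sigma^{\delta_i}(\iota(f))$; $L(M)$ is the $S$-submodule generated by $\iota(M)$. *)

(* Defs.v *)
(* Concrete model of the free algebra F = K<x_1..x_n>, the
   commutative polynomial ring P = K[x_ij], their quotients and graded free
   modules.  Polynomials are formal sums (lists of terms); two formal sums are
   equal as polynomials when all their coefficients agree (feq).  Quotient
   rings/modules are modelled by representatives modulo an ideal predicate.  *)
From HB Require Import structures.
From mathcomp Require Import all_boot all_algebra.
Set Implicit Arguments. Unset Strict Implicit. Unset Printing Implicit Defensive.
Import GRing.Theory.
Local Open Scope ring_scope.

Section FormalSums.
Variables (K : fieldType) (Mon : Type).
Variables (meq : Mon -> Mon -> bool) (mmul : Mon -> Mon -> Mon) (mdeg : Mon -> nat).

Definition fsum := seq (K * Mon).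

Definition coef (p : fsum) (m : Mon) : K := \sum_(t <- p | meq t.2 m) t.1.
Definition feq (p q : fsum) : Prop := forall m, coef p m = coef q m.
Definition fadd (p q : fsum) : fsum := p ++ q.
Definition fscale (c : K) (p : fsum) : fsum := [seq (c * t.1, t.2) | t <- p].
Definition fopp (p : fsum) : fsum := fscale (-1) p.
Definition fmul (p q : fsum) : fsum :=
  [seq (a.1 * b.1, mmul a.2 b.2) | a <- p, b <- q].
Definition fhomog (d : nat) (p : fsum) : fsum := [seq t <- p | mdeg t.2 == d].

Record is_ideal (Z : fsum -> Prop) : Prop := {
  id_feq : forall p q, feq p q -> Z p -> Z q;
  id_0 : Z [::];
  id_add : forall p q, Z p -> Z q -> Z (fadd p q);
  id_mull : forall a p, Z p -> Z (fmul a p);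
  id_mulr : forall p a, Z p -> Z (fmul p a) }.

Definition is_graded_ideal (Z : fsum -> Prop) : Prop :=
  is_ideal Z /\ forall p d, Z p -> Z (fhomog d p).

Definition ideal_gen (X : fsum -> Prop) (p : fsum) : Prop :=
  forall Z, is_ideal Z -> (forall x, X x -> Z x) -> Z p.

Variables (r : nat) (delta : 'I_r -> nat).

(* elements of the graded free module (+)_i B[-delta_i], B = (polys)/Z,
   given by representatives: e_i has degree delta_i *)
Definition vec := 'I_r -> fsum.
Definition qzero (Z : fsum -> Prop) (v : vec) : Prop := forall i, Z (v i).
Definition vadd (v w : vec) : vec := fun i => fadd (v i) (w i).
Definition vsub (v w : vec) : vec := fun i => fadd (v i) (fopp (w i)).
Definition vmulr (v : vec) (a : fsum) : vec := fun i => fmul (v i) a.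
Definition vcomp (d : nat) (v : vec) : vec :=
  fun i => if (delta i <= d)%N then fhomog (d - delta i) (v i) else [::].
Definition lhomog (d : nat) (v : vec) : Prop :=
  forall i m, coef (v i) m != 0 -> (mdeg m + delta i)%N = d.
Definition qhomog (Z : fsum -> Prop) (d : nat) (v : vec) : Prop :=
  exists w, qzero Z (vsub v w) /\ lhomog d w.

(* right submodule of (+)_i B[-delta_i] (B = polys/Z), represented by the
   set N of all representatives of its elements *)
Record is_submod (Z : fsum -> Prop) (N : vec -> Prop) : Prop := {
  sm_feq : forall v w, (forall i, feq (v i) (w i)) -> N v -> N w;
  sm_zero : forall v, qzero Z v -> N v;
  sm_add : forall v w, N v -> N w -> N (vadd v w);
  sm_mulr : forall v a, N v -> N (vmulr v a) }.

Definition is_graded_submod (Z : fsum -> Prop) (N : vec -> Prop) : Prop :=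
  is_submod Z N /\ forall v d, N v -> N (vcomp d v).

Definition gen (Z : fsum -> Prop) (X : vec -> Prop) (v : vec) : Prop :=
  forall N, is_submod Z N -> (forall x, X x -> N x) -> N v.

Definition is_basis (Z : fsum -> Prop) (N : vec -> Prop) (J : Type) (g : J -> vec)
  : Prop :=
  [/\ forall j, N (g j),
      forall j, exists d, qhomog Z d (g j)
    & forall v, N v -> gen Z (fun x => exists j, x = g j) v].

Definition is_min_basis (Z : fsum -> Prop) (N : vec -> Prop) (J : Type)
  (g : J -> vec) : Prop :=
  is_basis Z N g /\
  forall j, ~ gen Z (fun x => exists2 k, k <> j & x = g k) (g j).

End FormalSums.

Definition MonF (n : nat) := seq 'I_n.
Definition meqF (n : nat) (a b : MonF n) : bool := a == b.
Definition mmulF (n : nat) (a b : MonF n) : MonF n := a ++ b.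
Definition mdegF (n : nat) (a : MonF n) : nat := size a.
Definition polyF (K : fieldType) (n : nat) := fsum K (MonF n).
Definition vecF (K : fieldType) (n r : nat) := vec K (MonF n) r.

(* ---------- P = K[x_ij | 1 <= i <= n, j >= 1] (commutative) ----------
   the pair (i, j) : 'I_n * nat stands for the variable x_{i+1, j+1};
   commutative monomials are lists of variables up to permutation. *)
Definition MonP (n : nat) := seq ('I_n * nat).
Definition meqP (n : nat) (a b : MonP n) : bool := perm_eq a b.
Definition mmulP (n : nat) (a b : MonP n) : MonP n := a ++ b.
Definition mdegP (n : nat) (a : MonP n) : nat := size a.
Definition polyP (K : fieldType) (n : nat) := fsum K (MonP n).
Definition vecP (K : fieldType) (n r : nat) := vec K (MonP n) r.

Definition iota_mon (n : nat) (w : MonF n) : MonP n := zip w (iota 0 (size w)).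
Definition iotaF (K : fieldType) (n : nat) (p : polyF K n) : polyP K n :=
  [seq (t.1, iota_mon t.2) | t <- p].
Definition sigma_mon (n : nat) (m : MonP n) : MonP n := [seq (x.1, x.2.+1) | x <- m].
Definition sigmaP (K : fieldType) (n : nat) (p : polyP K n) : polyP K n :=
  [seq (t.1, sigma_mon t.2) | t <- p].

Definition Qgen (K : fieldType) (n : nat) (p : polyP K n) : Prop :=
  exists (i k : 'I_n) (j : nat), p = [:: (1, [:: (i, j); (k, j)])].
Definition Jgen (K : fieldType) (n : nat) (I : polyF K n -> Prop) (p : polyP K n)
  : Prop := exists f k, I f /\ p = iter k (@sigmaP K n) (iotaF f).
(* preimage in P of the ideal defining S = R/J = P/(Q+J) *)
Definition ZS (K : fieldType) (n : nat) (I : polyF K n -> Prop) : polyP K n -> Prop :=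
  ideal_gen (@meqP n) (@mmulP n) (fun p => Qgen p \/ Jgen I p).

Definition iotaV (K : fieldType) (n r : nat) (delta : 'I_r -> nat)
  (v : vecF K n r) : vecP K n r :=
  fun i => iter (delta i) (@sigmaP K n) (iotaF (v i)).

Definition Lmod (K : fieldType) (n r : nat) (I : polyF K n -> Prop)
  (delta : 'I_r -> nat) (M : vecF K n r -> Prop) : vecP K n r -> Prop :=
  gen (@meqP n) (@mmulP n) (ZS I) (fun x => exists v, M v /\ x = iotaV delta v).

Definition homogA K n r (I : polyF K n -> Prop) (delta : 'I_r -> nat) d (v : vecF K n r) :=
  qhomog (@meqF n) (@mdegF n) delta I d v.
Definition homogS K n r (I : polyF K n -> Prop) (delta : 'I_r -> nat) d (v : vecP K n r) :=
  qhomog (@meqP n) (@mdegP n) delta (ZS I) d v.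
Definition basisA K n r (I : polyF K n -> Prop) (delta : 'I_r -> nat) M J (g : J -> vecF K n r) :=
  is_basis (@meqF n) (@mmulF n) (@mdegF n) delta I M g.
Definition basisS K n r (I : polyF K n -> Prop) (delta : 'I_r -> nat) M' J (g : J -> vecP K n r) :=
  is_basis (@meqP n) (@mmulP n) (@mdegP n) delta (ZS I) M' g.
Definition min_basisA K n r (I : polyF K n -> Prop) (delta : 'I_r -> nat) M J (g : J -> vecF K n r) :=
  is_min_basis (@meqF n) (@mmulF n) (@mdegF n) delta I M g.
Definition min_basisS K n r (I : polyF K n -> Prop) (delta : 'I_r -> nat) M' J (g : J -> vecP K n r) :=
  is_min_basis (@meqP n) (@mmulP n) (@mdegP n) delta (ZS I) M' g.

(* Main.v *)
(* Write place k w for the monomial sigma^k (iota w), in which the letters of w occupy the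
   places k, ..., k + size w - 1.  Since place k (u w) = place k u * place (k + size u) w,
   multiplying iota v, for v homogeneous of degree e, by place e w amounts to multiplying v
   by the word w, so iota carries relations over A to relations over S.  Conversely, the
   linear left inverse of sigma^k o iota that kills all other monomials maps the ideal of S
   into I: if sigma^k (iota f) * m has a nonzero image, the letters of m fill the places
   around a fixed block, and the image is a f_d b for fixed words a, b and a homogeneous
   component f_d of f.  Likewise it maps iota v * m to a homogeneous component of v times a
   word.  Hence iota v lies in the S-submodule generated by iota N only if v lies in N, for
   every graded submodule N, and bases and minimal bases correspond.  For the Betti numbers,
   iota maps a minimal basis of M to one of L(M), and the number of elements of a given
   degree in a minimal basis is determined by the module, by a rank argument modulo the
   elements generated in lower degree; it is finite because a minimal basis of M is linearly
   independent over K and the free A-module has finite-dimensional graded pieces. *)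
Require Import Defs.
From mathcomp Require Import all_boot all_algebra.
From mathcomp Require Import boolp.
From mathcomp Require Import zify ring.
Set Implicit Arguments. Unset Strict Implicit. Unset Printing Implicit Defensive.
Import GRing.Theory.
Local Open Scope ring_scope.

(** * Graded free modules over quotients of monoid algebras *)

(** Common interface of words and commutative monomials, so that ideals and modules are treated
    once. Equality is a relation [meq] because commutative monomials are lists up to permutation.
    [mdeg_eq0] makes the degree-zero part consist of scalars, on which the rank argument for minimal
    bases rests. *)
Record graded_monoid (Mon : Type) (meq : Mon -> Mon -> bool)
  (mmul : Mon -> Mon -> Mon) (mdeg : Mon -> nat) (one : Mon) : Prop := {
  meq_refl : forall a, meq a a;
  meq_sym : forall a b, meq a b = meq b a;
  meq_trans : forall a b c, meq a b -> meq b c -> meq a c;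
  meq_mul : forall a a' b b', meq a a' -> meq b b' -> meq (mmul a b) (mmul a' b');
  meq_mulA : forall a b c, meq (mmul a (mmul b c)) (mmul (mmul a b) c);
  meq_mul1 : forall a, meq (mmul a one) a;
  mdeg_meq : forall a b, meq a b -> mdeg a = mdeg b;
  mdeg_mul : forall a b, mdeg (mmul a b) = (mdeg a + mdeg b)%N;
  mdeg_eq0 : forall a, mdeg a = 0%N -> meq a one }.

Definition monof (K : fieldType) (Mon : Type) (m : Mon) : fsum K Mon := [:: (1, m)].

Section GradedMonoid.
Context (K : fieldType) (Mon : Type) (meq : Mon -> Mon -> bool)
  (mmul : Mon -> Mon -> Mon) (mdeg : Mon -> nat) (one : Mon)
  (GM : graded_monoid meq mmul mdeg one).

Local Notation fsum := (fsum K Mon).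
Local Notation coef := (@coef K Mon meq).
Local Notation feq := (@feq K Mon meq).
Local Notation fmul := (@fmul K Mon mmul).
Local Notation fhomog := (@fhomog K Mon mdeg).
Local Notation is_ideal := (@is_ideal K Mon meq mmul).

(** * Linear functionals and coefficients of formal sums *)

Definition flin (phi : Mon -> K) (p : fsum) : K := \sum_(t <- p) t.1 * phi t.2.

Lemma flin_nil phi : flin phi [::] = 0.
Proof. by rewrite /flin big_nil. Qed.

Lemma flin_cons phi t p : flin phi (t :: p) = t.1 * phi t.2 + flin phi p.
Proof. by rewrite /flin big_cons. Qed.

Lemma flin_cat phi p q : flin phi (p ++ q) = flin phi p + flin phi q.
Proof. by rewrite /flin big_cat. Qed.

Lemma coef_flin p m : coef p m = flin (fun a => (meq a m)%:R) p.
Proof.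
rewrite /coef /flin big_mkcond /=; apply: eq_bigr => t _.
by case: ifP => _; rewrite ?mulr1 ?mulr0.
Qed.

Lemma coef_nil m : coef [::] m = 0.
Proof. by rewrite /coef big_nil. Qed.

Lemma coef_cat p q m : coef (p ++ q) m = coef p m + coef q m.
Proof. by rewrite /coef big_cat. Qed.

Lemma coef_add p q m : coef (fadd p q) m = coef p m + coef q m.
Proof. exact: coef_cat. Qed.

Lemma coef_fcons t p m : coef (t :: p) m = t.1 * (meq t.2 m)%:R + coef p m.
Proof. by rewrite !coef_flin flin_cons. Qed.

Lemma coef_scale c p m : coef (fscale c p) m = c * coef p m.
Proof. by rewrite /coef big_map mulr_sumr. Qed.

Lemma coef_opp p m : coef (fopp p) m = - coef p m.
Proof. by rewrite coef_scale mulN1r. Qed.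

Lemma meq_eq a b m : meq a b -> meq a m = meq b m.
Proof.
move=> ab; apply/idP/idP => h; last exact: (meq_trans GM) ab h.
by apply: (meq_trans GM) h; rewrite (meq_sym GM).
Qed.

Lemma coef_homog d p m : coef (fhomog d p) m = if mdeg m == d then coef p m else 0.
Proof.
rewrite /coef /fhomog big_filter_cond; case: eqP => [md|md].
  apply: eq_bigl => t; case h: (meq t.2 m); rewrite ?andbF //.
  by rewrite (mdeg_meq GM h) md eqxx.
apply: big_pred0 => t; case h: (meq t.2 m); rewrite ?andbF //.
by rewrite (mdeg_meq GM h); move/eqP/negbTE: md => ->.
Qed.

Lemma flin_filterC phi (P : pred (K * Mon)) p :
  flin phi p = flin phi (filter P p) + flin phi (filter (predC P) p).
Proof. by rewrite /flin !big_filter (bigID P). Qed.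

(** A functional that respects [meq] descends from formal sums to polynomials. Induction on the
    number of terms: those with monomial equivalent to the first one, m, contribute
    [coef p m * phi m], which vanishes, and removing them leaves all coefficients zero. *)
Lemma feq0_flin phi p : (forall a b, meq a b -> phi a = phi b) ->
  (forall m, coef p m = 0) -> flin phi p = 0.
Proof.
move=> phiE; elim: {p}_.+1 {-2}p (ltnSn (size p)) => // N IH [|[c m] p] szp p0.
  exact: flin_nil.
pose P := [pred t : K * Mon | meq t.2 m].
rewrite (flin_filterC _ P) [X in _ + X]IH ?addr0.
- have -> : flin phi (filter P ((c, m) :: p)) = coef ((c, m) :: p) m * phi m.
    rewrite /flin big_filter /coef mulr_suml; apply: eq_bigr => t /= tm.
    by rewrite (phiE _ _ tm).
  by rewrite p0 mul0r.
- rewrite /= (meq_refl GM) /=; apply: leq_ltn_trans (_ : (size p < N)%N) => //.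
  by rewrite size_filter count_size.
move=> m'; rewrite /coef big_filter_cond.
case mm': (meq m m').
  apply: big_pred0 => t /=; rewrite (meq_sym GM _ m').
  by rewrite -(meq_eq _ mm') (meq_sym GM m) andNb.
rewrite -[RHS](p0 m') /coef; apply: eq_bigl => t /=.
case tm: (meq t.2 m) => //=.
by rewrite (meq_eq _ tm) mm'.
Qed.

Lemma flin_feq phi p q : (forall a b, meq a b -> phi a = phi b) ->
  feq p q -> flin phi p = flin phi q.
Proof.
move=> phiE pq; have := @feq0_flin phi (fadd p (fopp q)) phiE.
rewrite flin_cat (_ : flin phi (fopp q) = - flin phi q) => [h|]; last first.
  rewrite /flin big_map -sumrN; apply: eq_bigr => t _ /=.
  by rewrite mulN1r mulNr.
by apply/eqP; rewrite -subr_eq0 h // => m; rewrite coef_add coef_opp pq subrr.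
Qed.

Lemma fmul_nil p : fmul p [::] = [::].
Proof. by rewrite /fmul; elim: p. Qed.

Lemma fmul_term p t : fmul p [:: t] = [seq (a.1 * t.1, mmul a.2 t.2) | a <- p].
Proof. by rewrite /fmul allpairs1r. Qed.

Lemma fmul_term_l t p : fmul [:: t] p = [seq (t.1 * a.1, mmul t.2 a.2) | a <- p].
Proof. by rewrite /fmul /= cats0. Qed.

Lemma fmul_cons_l t p q : fmul (t :: p) q = fmul [:: t] q ++ fmul p q.
Proof. by rewrite /fmul /= cats0. Qed.

Lemma flin_mul phi p q :
  flin phi (fmul p q) = flin (fun a => flin (fun b => phi (mmul a b)) q) p.
Proof.
rewrite /flin big_allpairs_dep /=; apply: eq_bigr => t _; rewrite mulr_sumr.
by apply: eq_bigr => u _; rewrite mulrA.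
Qed.

Lemma flinD phi psi p : flin (fun a => phi a + psi a) p = flin phi p + flin psi p.
Proof. by rewrite /flin -big_split; apply: eq_bigr => t _ /=; rewrite mulrDr. Qed.

Lemma eq_flin phi psi p : (forall a, phi a = psi a) -> flin phi p = flin psi p.
Proof. by move=> h; apply: eq_bigr => t _; rewrite h. Qed.

Lemma coef_mul_cons_r p t q m :
  coef (fmul p (t :: q)) m = coef (fmul p [:: t]) m + coef (fmul p q) m.
Proof.
rewrite !coef_flin !flin_mul -flinD; apply: eq_flin => a.
by rewrite !flin_cons flin_nil addr0.
Qed.

Lemma feq_mull p q a : feq p q -> feq (fmul p a) (fmul q a).
Proof.
move=> pq m; rewrite !coef_flin !flin_mul; apply: flin_feq => // b b' bb'.
by apply: eq_flin => c; congr (_%:R); rewrite (meq_eq _ (meq_mul GM bb' (meq_refl GM c))).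
Qed.

Lemma feq_mul1 p : feq (fmul p (monof K one)) p.
Proof.
move=> m; rewrite !coef_flin flin_mul; apply: eq_flin => a.
by rewrite flin_cons flin_nil addr0 mul1r /= (meq_eq _ (meq_mul1 GM a)).
Qed.

Lemma feq_mul_scalar p c m :
  meq m one -> feq (fmul p [:: (c, m)]) (fscale c p).
Proof.
move=> m1 x; rewrite coef_scale !coef_flin flin_mul /flin mulr_sumr.
apply: eq_bigr => t _; rewrite big_seq1 /= mulrCA; congr (_ * (_ * _%:R)).
rewrite (meq_eq _ (meq_mul GM (meq_refl GM t.2) m1)).
by rewrite (meq_eq _ (meq_mul1 GM _)).
Qed.

Lemma feq_term_assoc p t u :
  feq (fmul (fmul p [:: t]) [:: u]) (fmul p [:: (t.1 * u.1, mmul t.2 u.2)]).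
Proof.
move=> m; rewrite !coef_flin !fmul_term /flin !big_map.
apply: eq_bigr => a _ /=; rewrite mulrA.
by rewrite (meq_eq _ (meq_mulA GM _ _ _)).
Qed.

Lemma homog_mul_term d p t : fhomog d (fmul p [:: t]) =
  if (mdeg t.2 <= d)%N then fmul (fhomog (d - mdeg t.2) p) [:: t] else [::].
Proof.
rewrite !fmul_term /fhomog filter_map; case: leqP => h.
  by congr map; apply: eq_filter => a /=; rewrite (mdeg_mul GM); lia.
rewrite (eq_filter (a2 := pred0)) ?filter_pred0 // => a /=.
by rewrite (mdeg_mul GM); lia.
Qed.

Lemma homog_mul_term_l d p t : fhomog d (fmul [:: t] p) =
  if (mdeg t.2 <= d)%N then fmul [:: t] (fhomog (d - mdeg t.2) p) else [::].
Proof.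
rewrite !fmul_term_l /fhomog filter_map; case: leqP => h.
  by congr map; apply: eq_filter => a /=; rewrite (mdeg_mul GM); lia.
rewrite (eq_filter (a2 := pred0)) ?filter_pred0 // => a /=.
by rewrite (mdeg_mul GM); lia.
Qed.

Lemma homog_add d p q : fhomog d (fadd p q) = fadd (fhomog d p) (fhomog d q).
Proof. exact: filter_cat. Qed.

(** * Graded ideals *)

Lemma ideal_by_terms (Z : fsum -> Prop) :
  (forall p q, feq p q -> Z p -> Z q) -> Z [::] ->
  (forall p q, Z p -> Z q -> Z (fadd p q)) ->
  (forall t p, Z p -> Z (fmul [:: t] p)) ->
  (forall p t, Z p -> Z (fmul p [:: t])) -> is_ideal Z.
Proof.
move=> Zfeq Z0 ZD ZMl ZMr; split=> // [a p|p a] Zp.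
  by elim: a => [|t a IH] //; rewrite fmul_cons_l; apply: ZD => //; apply: ZMl.
(* Splitting the right factor reorders the list of products, so here the equality holds only between
   coefficients. *)
elim: a => [|t a IH]; first by rewrite fmul_nil.
apply: Zfeq (ZD _ _ (ZMr p t Zp) IH) => m.
by rewrite coef_add -coef_mul_cons_r.
Qed.

Lemma ideal_scale Z c p : is_ideal Z -> Z p -> Z (fscale c p).
Proof.
move=> idZ Zp; apply: (id_feq idZ) (id_mulr idZ [:: (c, one)] Zp).
exact: feq_mul_scalar (meq_refl GM _).
Qed.

Lemma ideal_gen_ideal X : is_ideal (ideal_gen meq mmul X).
Proof.
split=> [p q pq Xp|||a p Xp|p a Xp].
- by move=> Z idZ XZ; exact: (id_feq idZ pq (Xp _ idZ XZ)).
- by move=> Z idZ _; apply: (id_0 idZ).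
- by move=> p q Xp Xq Z idZ XZ; apply: (id_add idZ); [apply: Xp|apply: Xq].
- by move=> Z idZ XZ; apply: (id_mull idZ); apply: Xp.
- by move=> Z idZ XZ; apply: (id_mulr idZ); apply: Xp.
Qed.

(** The polynomials all of whose components lie in the generated ideal form an ideal, since a
    component of a product with a term is that term times a component, or zero. *)
Lemma ideal_gen_graded X :
  (forall x d, X x -> ideal_gen meq mmul X (fhomog d x)) ->
  is_graded_ideal meq mmul mdeg (ideal_gen meq mmul X).
Proof.
move=> Xh; have idX := ideal_gen_ideal X; split=> // p d Xp.
apply: (Xp (fun p => forall d, ideal_gen meq mmul X (fhomog d p))) => [|x Xx e]; last exact: Xh.
apply: ideal_by_terms => [{d p Xp}p q pq Zp e||{d p Xp}p q Zp Zq e|t {d p Xp}p Zp e|{d p Xp}p t Zp e].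
- apply: (id_feq idX) (Zp e) => m; rewrite !coef_homog; case: ifP => // _.
- by move=> e; apply: (id_0 idX).
- by rewrite homog_add; apply: (id_add idX).
- rewrite homog_mul_term_l; case: ifP => _; last exact: (id_0 idX).
  exact: (id_mull idX).
- rewrite homog_mul_term; case: ifP => _; last exact: (id_0 idX).
  exact: (id_mulr idX).
Qed.

(** * Graded submodules of a graded free module *)

Section Modules.
Context (r : nat) (delta : 'I_r -> nat) (Z : fsum -> Prop).
Hypothesis grZ : is_graded_ideal meq mmul mdeg Z.
Let idZ : is_ideal Z := proj1 grZ.

Local Notation vec := (vec K Mon r).
Local Notation vcomp := (@vcomp K Mon mdeg r delta).
Local Notation is_submod := (@is_submod K Mon meq mmul r Z).
Local Notation gen := (@gen K Mon meq mmul r Z).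
Local Notation qhomog := (@qhomog K Mon meq mdeg r delta Z).
Local Notation vmulr := (@vmulr K Mon mmul r).

Definition vfeq (v w : vec) := forall i, feq (v i) (w i).
Definition vnil : vec := fun=> [::].
Definition vscale c (v : vec) : vec := fun i => fscale c (v i).

Lemma coef_vcomp d v i m :
  coef (vcomp d v i) m = if (mdeg m + delta i == d)%N then coef (v i) m else 0.
Proof.
rewrite /Defs.vcomp; case: leqP => h; last by rewrite coef_nil ifF //; lia.
by rewrite coef_homog; congr (if _ then _ else _); lia.
Qed.

Lemma coef_vadd (v w : vec) i m : coef (vadd v w i) m = coef (v i) m + coef (w i) m.
Proof. exact: coef_add. Qed.

Lemma coef_vsub (v w : vec) i m : coef (vsub v w i) m = coef (v i) m - coef (w i) m.
Proof. by rewrite coef_add coef_opp. Qed.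

Lemma coef_vscale c (v : vec) i m : coef (vscale c v i) m = c * coef (v i) m.
Proof. exact: coef_scale. Qed.

Lemma coef_vnil i m : coef (vnil i) m = 0.
Proof. exact: coef_nil. Qed.

Definition coefVE := (coef_vcomp, coef_vadd, coef_vsub, coef_vscale, coef_vnil).

Lemma vcomp_feq d v w : vfeq v w -> vfeq (vcomp d v) (vcomp d w).
Proof. by move=> vw i m; rewrite !coef_vcomp vw. Qed.

Lemma vcomp_term d v t : vfeq (vcomp d (vmulr v [:: t]))
  (if (mdeg t.2 <= d)%N then vmulr (vcomp (d - mdeg t.2) v) [:: t] else vnil).
Proof.
move=> i m; rewrite /Defs.vcomp /Defs.vmulr homog_mul_term /=.
case: (leqP (mdeg t.2) d) => h1.
  case: (leqP (delta i) (d - mdeg t.2)) => h2.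
    have -> : (delta i <= d)%N by lia.
    have -> : (mdeg t.2 <= d - delta i)%N by lia.
    by rewrite subnAC.
  by case: ifP => // h3; rewrite ifF //; lia.
by case: ifP => // h2; rewrite ifF //; lia.
Qed.

Lemma qzero_feq (v w : vec) : vfeq v w -> qzero Z v -> qzero Z w.
Proof. by move=> vw Zv i; apply: (id_feq idZ) (vw i) (Zv i). Qed.

Lemma qzero_vnil : qzero Z vnil.
Proof. by move=> i; apply: (id_0 idZ). Qed.

Lemma qzero_add (v w : vec) : qzero Z v -> qzero Z w -> qzero Z (vadd v w).
Proof. by move=> Zv Zw i; apply: (id_add idZ). Qed.

Lemma qzero_vcomp d (v : vec) : qzero Z v -> qzero Z (vcomp d v).
Proof.
move=> Zv i; rewrite /Defs.vcomp; case: ifP => _; last exact: (id_0 idZ).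
by apply: (proj2 grZ).
Qed.

Lemma submod_by_terms (N : vec -> Prop) :
  (forall v w, vfeq v w -> N v -> N w) -> (forall v, qzero Z v -> N v) ->
  (forall v w, N v -> N w -> N (vadd v w)) ->
  (forall v t, N v -> N (vmulr v [:: t])) -> is_submod N.
Proof.
move=> Nfeq N0 ND NM; split=> // v a Nv; elim: a => [|t a IH].
  by apply: N0 => i; rewrite /Defs.vmulr fmul_nil; apply: (id_0 idZ).
apply: Nfeq (ND _ _ (NM v t Nv) IH) => i m.
by rewrite coef_vadd /Defs.vmulr -coef_mul_cons_r.
Qed.

Lemma submod_scale N c v : is_submod N -> N v -> N (vscale c v).
Proof.
move=> smN Nv; apply: (sm_feq smN) (sm_mulr smN [:: (c, one)] Nv) => i.
exact: feq_mul_scalar (meq_refl GM _).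
Qed.

Lemma submod_sub N v w : is_submod N -> N v -> N w -> N (vsub v w).
Proof. by move=> smN Nv Nw; apply: (sm_add smN) Nv (submod_scale (-1) smN Nw). Qed.

Lemma submod_vnil N : is_submod N -> N vnil.
Proof. by move=> smN; apply: (sm_zero smN) qzero_vnil. Qed.

Lemma submod_subK N v w : is_submod N -> N (vsub v w) -> N w -> N v.
Proof.
move=> smN Nvw Nw; apply: (sm_feq smN) (sm_add smN Nvw Nw) => i m.
by rewrite !coefVE subrK.
Qed.

Lemma qzero_submod : is_submod (qzero Z).
Proof.
apply: submod_by_terms => //; [exact: qzero_feq | exact: qzero_add |].
by move=> v t Zv i; apply: (id_mulr idZ).
Qed.

Lemma gen_submod X : is_submod (gen X).
Proof.
split=> [v w vw Xv|v Zv|v w Xv Xw|v a Xv] N smN XN.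
- exact: (sm_feq smN) vw (Xv _ smN XN).
- exact: (sm_zero smN).
- by apply: (sm_add smN); [apply: Xv | apply: Xw].
- by apply: (sm_mulr smN); apply: Xv.
Qed.

Lemma gen_in (X : vec -> Prop) v : X v -> gen X v.
Proof. by move=> Xv N _; apply. Qed.

Lemma gen_sub (X Y : vec -> Prop) : (forall v, X v -> gen Y v) -> forall v, gen X v -> gen Y v.
Proof. by move=> XY v; apply=> //; apply: gen_submod. Qed.

(** A vector is the finite sum of its components: the truncations below degree D are built by adding
    one component at a time, and for large D nothing is cut off. *)
Lemma vcomp_sum_ind (N : vec -> Prop) : (forall v w, vfeq v w -> N v -> N w) ->
  N vnil -> (forall v w, N v -> N w -> N (vadd v w)) ->
  forall v, (forall d, N (vcomp d v)) -> N v.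
Proof.
move=> Nfeq N0 ND v Nv.
pose trunc D : vec := fun i => [seq t <- v i | (mdeg t.2 + delta i < D)%N].
have coefT D i m : coef (trunc D i) m =
    if (mdeg m + delta i < D)%N then coef (v i) m else 0.
  rewrite /coef /trunc big_filter_cond; case: ifP => [md|md].
    apply: eq_bigl => t; case h: (meq t.2 m); rewrite ?andbF //.
    by rewrite (mdeg_meq GM h) md.
  apply: big_pred0 => t; case h: (meq t.2 m); rewrite ?andbF //.
  by rewrite (mdeg_meq GM h) md.
have NT D : N (trunc D).
  elim: D => [|D IH].
    by apply: Nfeq N0 => i m; rewrite coefT coef_nil.
  apply: Nfeq (ND _ _ IH (Nv D)) => i m; rewrite !coefVE !coefT ltnS.
  by case: ltngtP => _; rewrite ?addr0 ?add0r.
(* D exceeds the degree of every term of v, including terms that cancel, so the filter in [trunc D]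
   removes nothing. *)
pose D := (\max_(i < r) \max_(t <- v i) (mdeg t.2 + delta i)%N).+1.
suff : vfeq (trunc D) v by move=> h; apply: Nfeq h (NT D).
move=> i m; rewrite /trunc (_ : filter _ _ = v i) //.
have : all (fun t => (mdeg t.2 + delta i < D)%N) (v i).
  have : (\max_(t <- v i) (mdeg t.2 + delta i) < D)%N.
    by rewrite ltnS; apply: (leq_bigmax (F := fun i => \max_(t <- v i) (mdeg t.2 + delta i)%N)).
  elim: (v i) => //= t s IH; rewrite big_cons; rewrite gtn_max => /andP[-> /IH ->] //.
by move/all_filterP.
Qed.

Lemma lhomog_vcomp d v : lhomog meq mdeg delta d v -> vfeq v (vcomp d v).
Proof.
move=> hv i m; rewrite coef_vcomp; case: eqP => // md.
by case: (coef (v i) m =P 0) => // /eqP /hv.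
Qed.

Lemma vcomp_lhomog d v : lhomog meq mdeg delta d (vcomp d v).
Proof. by move=> i m; rewrite coef_vcomp; case: ifP => [/eqP|_]; rewrite ?eqxx. Qed.

Lemma qhomog_vcomp_neq d e v : qhomog d v -> e != d -> qzero Z (vcomp e v).
Proof.
move=> [w [Zvw hw]] ed; apply: qzero_feq (qzero_vcomp e Zvw) => i m.
rewrite !coefVE (lhomog_vcomp hw) coef_vcomp; case: eqP => // ->.
by rewrite (negbTE ed) subr0.
Qed.

Lemma qhomog_vcomp d v : qhomog d v -> qzero Z (vsub v (vcomp d v)).
Proof.
move=> [w [Zvw hw]].
have Z2 := submod_sub qzero_submod Zvw (qzero_vcomp d Zvw).
apply: qzero_feq Z2 => i m; rewrite !coefVE (lhomog_vcomp hw) // coef_vcomp.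
by case: ifP => _; ring.
Qed.

Lemma qhomog_unique d e v : qhomog d v -> qhomog e v -> d != e -> qzero Z v.
Proof.
move=> hd he de; apply: submod_subK (qhomog_vcomp hd) _; first exact: qzero_submod.
exact: qhomog_vcomp_neq he de.
Qed.

Lemma qhomog_vcomp_mem N d e v : is_submod N -> qhomog d v -> N v -> N (vcomp e v).
Proof.
move=> smN hv Nv; have [->|ed] := eqVneq e d; last first.
  by apply: (sm_zero smN); apply: qhomog_vcomp_neq hv ed.
have := submod_sub smN Nv (sm_zero smN (qhomog_vcomp hv)).
by apply: (sm_feq smN) => i m; rewrite !coefVE; ring.
Qed.

(** Multiplying by a term raises degrees, so a component of degree e of the product comes from one
    of degree at most e; hence P must be closed downwards. It is used with P always true and with P
    the degrees below d. *)
Lemma vcomp_submod (P : nat -> Prop) N : (forall e f, (e <= f)%N -> P f -> P e) ->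
  is_submod N -> is_submod (fun v => forall e, P e -> N (vcomp e v)).
Proof.
move=> Pdown smN.
apply: submod_by_terms => [v w vw Nv e Pe|v Zv e Pe|v w Nv Nw e Pe|v t Nv e Pe].
- exact: (sm_feq smN) (vcomp_feq e vw) (Nv e Pe).
- by apply: (sm_zero smN); apply: qzero_vcomp.
- apply: (sm_feq smN) (sm_add smN (Nv e Pe) (Nw e Pe)) => i m; rewrite !coefVE.
  by case: ifP; rewrite ?addr0.
- apply: (sm_feq smN) (fun i m => esym (vcomp_term e v t i m)) _.
  case: ifP => _; last exact: submod_vnil.
  by apply: (sm_mulr smN); apply: Nv; apply: Pdown Pe; apply: leq_subr.
Qed.

Lemma gen_graded (X : vec -> Prop) : (forall x, X x -> exists d, qhomog d x) ->
  is_graded_submod meq mmul mdeg delta Z (gen X).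
Proof.
move=> Xh; have smX := gen_submod X; split=> // v d Xv.
apply: (Xv (fun v => forall d, True -> gen X (vcomp d v))) => // [|x Xx e _].
  exact: vcomp_submod.
by have [d' hx] := Xh x Xx; apply: (qhomog_vcomp_mem e smX hx); apply: gen_in.
Qed.

(** * Linear combinations and the rank argument for minimal bases *)

Definition vlin k (c : 'I_k -> K) (u : 'I_k -> vec) : vec :=
  fun i => flatten [seq fscale (c j) (u j i) | j <- enum 'I_k].

Lemma coef_vlin k c (u : 'I_k -> vec) i m :
  coef (vlin c u i) m = \sum_j c j * coef (u j i) m.
Proof.
rewrite /vlin -[LHS]/(coef (flatten _) m) -big_enum /=.
elim: (enum _) => [|j s IH] /=; first by rewrite coef_nil big_nil.
by rewrite coef_cat coef_scale IH big_cons.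
Qed.

Lemma submod_vlin N k c (u : 'I_k -> vec) :
  is_submod N -> (forall j, c j != 0 -> N (u j)) -> N (vlin c u).
Proof.
move=> smN Nu; rewrite /vlin; elim: (enum _) => [|j s IH]; first exact: submod_vnil.
suff Nj : N (vscale (c j) (u j)) by apply: (sm_add smN) Nj IH.
have [c0|/Nu] := eqVneq (c j) 0; last exact: submod_scale.
by apply: (sm_feq smN) (submod_vnil smN) => i m; rewrite !coefVE c0 mul0r.
Qed.

(** Modulo the submodule G generated in degrees below d, an element of degree d is a K-linear
    combination of the generators of degree d. The vectors with components below d in G and degree-d
    component in G plus that span form a submodule containing all generators. *)
Lemma gen_homog_decomp (J : Type) (X : J -> vec) d k (u : 'I_k -> J) v :
  (forall j, exists e, qhomog e (X j)) ->
  (forall j, qhomog d (X j) -> exists l, u l = j) ->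
  gen (fun x => exists j, x = X j) v -> qhomog d v ->
  exists c, gen (fun x => exists2 j, (exists2 e, (e < d)%N & qhomog e (X j)) & x = X j)
    (vsub v (vlin c (X \o u))).
Proof.
move=> Xh Xd Xv hv; set G := gen _.
have smG : is_submod G by apply: gen_submod.
pose N v := (forall e, (e < d)%N -> G (vcomp e v)) /\
  exists c, G (vsub (vcomp d v) (vlin c (X \o u))).
suff [_ [c Gc]] : N v.
  exists c; have := sm_add smG (sm_zero smG (qhomog_vcomp hv)) Gc.
  by apply: (sm_feq smG) => i m; rewrite !coefVE; ring.
apply: Xv => [|_ [j ->]]; last first.
  have [e0 he0] := Xh j.
  have lt e : (e < d)%N -> G (vcomp e (X j)).
    move=> ed; have [ee|ee] := eqVneq e e0; last first.
      by apply: (sm_zero smG); apply: qhomog_vcomp_neq he0 ee.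
    apply: (qhomog_vcomp_mem e smG he0); apply: gen_in.
    by exists j => //; exists e0 => //; rewrite -ee.
  split=> //; have [ed|ed] := eqVneq e0 d.
    rewrite {}ed in he0; have [l ul] := Xd j he0.
    exists (fun l' => (l' == l)%:R); apply: (sm_zero smG).
    apply: qzero_feq (submod_scale (-1) qzero_submod (qhomog_vcomp he0)) => i m.
    rewrite !coefVE coef_vlin (bigD1 l) //= eqxx ul big1 => [|l' /negbTE ->].
      by rewrite mulN1r opprB mul1r addr0.
    by rewrite mul0r.
  exists (fun=> 0); apply: (sm_zero smG).
  have hz : qzero Z (vcomp d (X j)) by apply: qhomog_vcomp_neq he0 _; rewrite eq_sym.
  apply: qzero_feq hz => i m.
  by rewrite !coefVE coef_vlin big1 ?subr0 // => l _; rewrite mul0r.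
apply: submod_by_terms => [{hv}v w vw [N1 [c N2]]|{hv}v Zv|{hv}v w [N1 [c N2]] [N3 [c' N4]]|].
- split=> [e ed|]; first exact: (sm_feq smG) (vcomp_feq e vw) (N1 e ed).
  by exists c; apply: (sm_feq smG) N2 => i m; rewrite !coefVE vw.
- split=> [e ed|]; first by apply: (sm_zero smG); apply: qzero_vcomp.
  exists (fun=> 0); apply: (sm_zero smG).
  apply: qzero_feq (qzero_vcomp d Zv) => i m.
  by rewrite !coefVE coef_vlin big1 ?subr0 // => l _; rewrite mul0r.
- split=> [e ed|].
    apply: (sm_feq smG) (sm_add smG (N1 e ed) (N3 e ed)) => i m; rewrite !coefVE.
    by case: ifP; rewrite ?addr0.
  exists (fun l => c l + c' l).
  apply: (sm_feq smG) (sm_add smG N2 N4) => i m; rewrite !coefVE !coef_vlin.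
  under [in RHS]eq_bigr do rewrite mulrDl.
  rewrite big_split /=; case: ifP => _; ring.
(* A term of degree zero acts as the scalar a. A term of positive degree carries components below d,
   which lie in G, into degrees up to d, so no linear combination is left. *)
move=> {hv}v [a x] [N1 [c N2]]; have [x0|x0] := posnP (mdeg x).
  have vE e : vfeq (vcomp e (vmulr v [:: (a, x)])) (vscale a (vcomp e v)).
    move=> i m; rewrite vcomp_term /= x0 /= subn0.
    by rewrite feq_mul_scalar //; apply: (mdeg_eq0 GM).
  split=> [e ed|].
    by apply: (sm_feq smG) (fun i m => esym (vE e i m)) (submod_scale a smG (N1 e ed)).
  exists (fun l => a * c l).
  apply: (sm_feq smG) (submod_scale a smG N2) => i m.
  rewrite coef_vsub vE !(coef_vscale, coef_vsub, coef_vlin).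
  by under [in RHS]eq_bigr do rewrite -mulrA; rewrite -mulr_sumr mulrBr.
have Nle e : (e <= d)%N -> G (vcomp e (vmulr v [:: (a, x)])).
  move=> ed; apply: (sm_feq smG) (fun i m => esym (vcomp_term e v _ i m)) _ => /=.
  case: ifP => xe; last exact: submod_vnil.
  by apply: (sm_mulr smG); apply: N1; lia.
split=> [e /ltnW|]; first exact: Nle.
exists (fun=> 0); apply: (sm_feq smG) (Nle d (leqnn d)) => i m.
by rewrite coef_vsub coef_vlin big1 ?subr0 // => l _; rewrite mul0r.
Qed.

(* If m > k, a vector in the left kernel of the matrix C yields a relation between the y_i
   modulo G, which expresses one of them through the other basis elements. *)
Lemma irredundant_bound (J : Type) (X : J -> vec) (G : vec -> Prop) m k
    (y : 'I_m -> J) (u : 'I_k -> vec) (C : 'I_m -> 'I_k -> K) :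
  (forall j, ~ gen (fun x => exists2 l, l <> j & x = X l) (X j)) ->
  injective y -> is_submod G ->
  (forall i v, G v -> gen (fun x => exists2 l, l <> y i & x = X l) v) ->
  (forall i, G (vsub (X (y i)) (vlin (C i) u))) -> (m <= k)%N.
Proof.
move=> irr yinj smG Gsub Gy; rewrite leqNgt; apply/negP => km.
pose A := \matrix_(i, j) C i j.
have /matrix0Pn[i1 [i0 ai0]] : kermx A != 0.
  by rewrite -mxrank_eq0 mxrank_ker -lt0n subn_gt0; apply: leq_ltn_trans (rank_leq_col A) km.
pose a i := kermx A i1 i; rewrite -/(a i0) in ai0.
have aC j : \sum_i a i * C i j = 0.
  transitivity ((kermx A *m A) i1 j); last by rewrite mulmx_ker mxE.
  by rewrite [RHS]mxE; apply: eq_bigr => i _; rewrite [A i j]mxE.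
apply: (irr (y i0)); set O := gen _.
have smO : is_submod O by apply: gen_submod.
have O1 : O (vlin a (fun i => vsub (X (y i)) (vlin (C i) u))).
  by apply: Gsub; apply: submod_vlin => // i _.
have O2 : O (vlin (fun i => if i == i0 then 0 else - a i) (X \o y)).
  apply: submod_vlin => // i; case: (i =P i0) => [_|ii0 _]; first by rewrite eqxx.
  by apply: gen_in; exists (y i) => // e; apply: ii0; apply: yinj.
apply: (sm_feq smO) (submod_scale (a i0)^-1 smO (sm_add smO O1 O2)) => i x.
rewrite coef_vscale coef_vadd !coef_vlin.
under eq_bigr do rewrite coef_vsub coef_vlin mulrBr.
rewrite sumrB [X in _ - X](_ : _ = 0) ?subr0; last first.
  under eq_bigr do rewrite mulr_sumr.
  rewrite exchange_big big1 //= => j _.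
  by under eq_bigr do rewrite mulrA; rewrite -mulr_suml aC mul0r.
rewrite -big_split /= (bigD1 i0) //= eqxx mul0r addr0 big1 ?addr0 ?mulKf //.
by move=> j /negbTE ->; rewrite mulNr subrr.
Qed.

(** Only the zero class is homogeneous of two degrees, and a minimal basis does not contain it. *)
Lemma min_basis_degree_unique N (J : Type) (X : J -> vec) j d e :
  is_min_basis meq mmul mdeg delta Z N X -> qhomog d (X j) -> qhomog e (X j) -> d = e.
Proof.
move=> [_ irr] hd he; have [//|de] := eqVneq d e; case: (irr j).
by apply: (sm_zero (gen_submod _)); apply: qhomog_unique hd he de.
Qed.

(** Modulo the elements of X of degree below d, each [Y (y i)] is a combination of the k elements of
    X of degree d, so [irredundant_bound] applies with G generated by the former. *)
Lemma min_basis_card_le N (J1 J2 : Type) (X : J1 -> vec) (Y : J2 -> vec) d m k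
    (x : 'I_k -> J1) (y : 'I_m -> J2) :
  is_min_basis meq mmul mdeg delta Z N X -> is_min_basis meq mmul mdeg delta Z N Y ->
  (forall j, qhomog d (X j) -> exists l, x l = j) ->
  injective y -> (forall i, qhomog d (Y (y i))) -> (m <= k)%N.
Proof.
move=> mX mY Xd yinj Yd; have [[NX hX genX] irrX] := mX; have [[NY hY genY] irrY] := mY.
have [C Cy] := choice (fun i => gen_homog_decomp hX Xd (genX _ (NY (y i))) (Yd i)).
apply: irredundant_bound irrY yinj (gen_submod _) _ Cy => i v.
apply: gen_sub => {}v [j [e ed hj] ->].
have smO := gen_submod (fun x => exists2 l, l <> y i & x = Y l).
apply: submod_subK (sm_zero smO (qhomog_vcomp hj)) _ => //.
(* In degrees below d, every element of N is generated by the members of Y other than [Y (y i)]: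
   that one has degree d, so its components below d are zero. *)
apply: (genY _ (NX j) _ (vcomp_submod (P := fun f => (f < d)%N) _ smO)) (ed) => [e1 e2|_ [l ->] f fd].
  exact: leq_ltn_trans.
have [lyi|lyi] := pselect (l = y i).
  apply: (sm_zero smO); apply: (qhomog_vcomp_neq (d := d)); last by rewrite neq_ltn fd.
  by rewrite lyi.
have [f' hl] := hY l; apply: (qhomog_vcomp_mem f smO hl); apply: gen_in.
by exists l.
Qed.

End Modules.
End GradedMonoid.

(** * Words, monomials and places *)

Lemma free_graded_monoid n : graded_monoid (@meqF n) (@mmulF n) (@mdegF n) [::].
Proof.
rewrite /meqF /mmulF /mdegF; split=> //.
- by move=> a b c /eqP -> /eqP ->.
- by move=> a a' b b' /eqP -> /eqP ->.
- by move=> a b c; rewrite catA.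
- by move=> a; rewrite cats0.
- by move=> a b /eqP ->.
- by move=> a b; rewrite size_cat.
- by move=> a /size0nil ->.
Qed.

Lemma commutative_graded_monoid n :
  graded_monoid (@meqP n) (@mmulP n) (@mdegP n) [::].
Proof.
rewrite /meqP /mmulP /mdegP; split=> //.
- exact: perm_sym.
- by move=> a b c; apply: perm_trans.
- by move=> a a' b b'; apply: perm_cat.
- by move=> a b c; rewrite catA.
- by move=> a; rewrite cats0.
- by move=> a b; apply: perm_size.
- by move=> a b; rewrite size_cat.
- by move=> a /size0nil ->.
Qed.

Section Places.
Context (n : nat).
Implicit Types (k : nat) (u w a b : MonF n) (m : MonP n).

Definition place k w : MonP n := zip w (iota k (size w)).

Lemma size_place k w : size (place k w) = size w.
Proof. by rewrite size_zip size_iota minnn. Qed.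

Lemma place_cat k u w : place k (u ++ w) = place k u ++ place (k + size u) w.
Proof. by rewrite /place size_cat iotaD zip_cat // size_iota. Qed.

Lemma place_cons k (a : 'I_n) w : place k (a :: w) = (a, k) :: place k.+1 w.
Proof. by []. Qed.

Lemma places_place k w : [seq x.2 | x <- place k w] = iota k (size w).
Proof. by rewrite -/(unzip2 _) unzip2_zip // size_iota. Qed.

Lemma mem_place x k w : x \in place k w -> (k <= x.2 < k + size w)%N.
Proof. by move=> /(map_f snd); rewrite places_place mem_iota. Qed.

Lemma iter_sigma_iota k w : iter k (@sigma_mon n) (iota_mon w) = place k w.
Proof.
elim: k => //= k ->; rewrite /sigma_mon /place.
by elim: w k => //= a w IH k; rewrite IH.
Qed.

(** Only the first letter of w stands at place k, so the first letters of u and w agree and cancel;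
    the induction continues at place k + 1. *)
Lemma place_prefix k u m w : perm_eq (place k u ++ m) (place k w) ->
  exists2 b, w = u ++ b & perm_eq m (place (k + size u) b).
Proof.
elim: u k w => [|a u IH] k w; first by rewrite addn0; exists w.
case: w => [/perm_size //|c w]; rewrite !place_cons /= => h.
have : (a, k) \in (c, k) :: place k.+1 w by rewrite -(perm_mem h) mem_head.
rewrite inE => /orP[/eqP[ac]|/mem_place]; last by rewrite /= ltnn.
move: h; rewrite ac perm_cons => /IH[b -> mb]; exists b => //.
by rewrite addnS.
Qed.

Lemma place_inj k u w : perm_eq (place k u) (place k w) -> u = w.
Proof.
rewrite -[place k u]cats0 => /place_prefix[b ->].
by rewrite perm_sym => /perm_nilP; case: b => //; rewrite cats0.
Qed.

Lemma eq_place k u w : perm_eq (place k u) (place k w) = (u == w).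
Proof. by apply/idP/eqP => [/place_inj|->]. Qed.

(* The letters of m fill the places around the block k, ..., k + size u - 1, so replacing
   that block by another word of the same length is two-sided concatenation by a and b. *)
Lemma place_block k u m l w : perm_eq (place k u ++ m) (place l w) ->
  exists a b, forall u', size u' = size u ->
    perm_eq (place k u' ++ m) (place l (a ++ u' ++ b)).
Proof.
(* An empty block does not constrain k, so a is all of w and b is empty. *)
have [/size0nil -> /= h|u0 h] := posnP (size u).
  by exists w, [::] => u' /size0nil ->; rewrite !cats0.
have szP : [seq x.2 | x <- place k u ++ m] =i iota l (size w).
  by move=> x; rewrite (perm_mem (perm_map snd h)) places_place.
have in_places j : (k <= j < k + size u)%N -> (l <= j < l + size w)%N.
  by rewrite -!mem_iota -szP map_cat mem_cat places_place => ->.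
have lk : (l <= k)%N by have := in_places k; lia.
have ku : (k + size u <= l + size w)%N by have := in_places (k + size u).-1; lia.
pose a := take (k - l) w; pose v := take (size u) (drop (k - l) w).
pose b := drop (size u) (drop (k - l) w).
have wE : w = a ++ v ++ b by rewrite !cat_take_drop.
have sa : size a = (k - l)%N by rewrite size_takel; lia.
have sv : size v = size u by rewrite size_takel ?size_drop; lia.
(* Filtering both sides by whether a place lies in the block compares the letters inside and outside
   it separately. *)
pose inb (x : 'I_n * nat) := (k <= x.2 < k + size u)%N.
have filter_block u' : size u' = size u ->
    filter inb (place k u') = place k u' /\ filter (predC inb) (place k u') = [::].
  move=> su; split; last first.
    rewrite -(filter_pred0 (place k u')); apply: eq_in_filter => x /mem_place.
    by rewrite su /inb /= => ->.
  by apply/all_filterP/allP => x /mem_place; rewrite su.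
have filter_a : filter (predC inb) (place l a) = place l a /\ filter inb (place l a) = [::].
  split; first by apply/all_filterP/allP => x /mem_place /=; rewrite /inb; lia.
  rewrite -(filter_pred0 (place l a)); apply: eq_in_filter => x /mem_place.
  by rewrite /inb /=; lia.
have filter_b : filter (predC inb) (place (k + size u) b) = place (k + size u) b
    /\ filter inb (place (k + size u) b) = [::].
  split; first by apply/all_filterP/allP => x /mem_place /=; rewrite /inb; lia.
  rewrite -(filter_pred0 (place (k + size u) b)); apply: eq_in_filter => x /mem_place.
  by rewrite /inb /=; lia.
move: h; rewrite wE !place_cat sa sv subnKC // => h.
have h1 := perm_filter inb h; have h2 := perm_filter (predC inb) h.
rewrite !filter_cat (filter_block _ erefl).1 (filter_block _ sv).1 filter_a.2 filter_b.2 in h1.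
rewrite !filter_cat (filter_block _ erefl).2 (filter_block _ sv).2 filter_a.1 filter_b.1 in h2.
(* Within the block the right side has exactly [size u] letters, all matched by u, so m has none
   there. *)
have m_inb : filter inb m = [::].
  apply: size0nil; move/perm_size: h1.
  by rewrite /= !size_cat !size_place sv /=; lia.
have mE : filter (predC inb) m = m.
  by rewrite -[RHS](filter_predT m); apply: eq_in_filter => x xm /=; apply/negP => xi;
    have := mem_filter inb x m; rewrite m_inb xm xi.
exists a, b => u' su; rewrite !place_cat sa su subnKC //.
rewrite -mE perm_sym perm_catCA perm_cat2l perm_sym.
by move: h2; rewrite /=.
Qed.

End Places.

(** * The letterplace map on ideals and modules *)

Section Iota.
Context (K : fieldType) (n : nat) (I : polyF K n -> Prop).
Hypothesis grI : is_graded_ideal (@meqF n) (@mmulF n) (@mdegF n) I.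
Let idI := proj1 grI.
Let GF := free_graded_monoid n.
Let GP := commutative_graded_monoid n.

Local Notation coefF := (@coef K _ (@meqF n)).
Local Notation coefP := (@coef K _ (@meqP n)).
Local Notation fmulF := (@fmul K _ (@mmulF n)).
Local Notation fmulP := (@fmul K _ (@mmulP n)).
Local Notation feqF := (@feq K _ (@meqF n)).
Local Notation feqP := (@feq K _ (@meqP n)).

Definition placef k (f : polyF K n) : Defs.polyP K n := [seq (t.1, place k t.2) | t <- f].

Lemma iter_sigma_iotaF k f : iter k (@sigmaP K n) (iotaF f) = placef k f.
Proof.
rewrite /placef; under eq_map do rewrite -iter_sigma_iota.
by elim: k => //= k ->; rewrite /sigmaP -map_comp.
Qed.

Lemma coef_placef k f w : coefP (placef k f) (place k w) = coefF f w.
Proof. by rewrite /coef big_map; apply: eq_bigl => t; apply: eq_place. Qed.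

Lemma feq_placef k f g : feqF f g -> feqP (placef k f) (placef k g).
Proof.
move=> fg m; rewrite !coef_flin /flin !big_map.
by apply: (flin_feq GF (phi := fun u => (meqP (place k u) m)%:R)) => // a b /eqP ->.
Qed.

Lemma ZS_placef k f : I f -> ZS I (placef k f).
Proof.
move=> If Z idZ; apply; right.
by exists f, k; rewrite iter_sigma_iotaF.
Qed.

Lemma ZS_ideal : is_ideal (@meqP n) (@mmulP n) (ZS I).
Proof. exact: ideal_gen_ideal. Qed.

Lemma homog_placef d k f : fhomog (@mdegP n) d (placef k f) = placef k (fhomog (@mdegF n) d f).
Proof.
rewrite /fhomog filter_map; congr map; apply: eq_filter => t /=.
by rewrite /mdegP size_place.
Qed.

(** Generators of Q are single terms, and the components of a shifted image of f are the shifted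
    images of the components of f, which lie in I because I is graded. *)
Lemma ZS_graded : is_graded_ideal (@meqP n) (@mmulP n) (@mdegP n) (ZS I).
Proof.
apply: (ideal_gen_graded GP) => x d Xx; have [Qx|[f [k [If ->]]]] := Xx; last first.
  by rewrite iter_sigma_iotaF homog_placef; apply: ZS_placef; apply: (proj2 grI).
have [i [k [j xE]]] := Qx; rewrite xE /fhomog /=; case: eqP => _; last exact: id_0 ZS_ideal.
by rewrite -xE => Z _; apply.
Qed.

(* [unplaces k p f]: f is the image of p under the K-linear left inverse of sigma^k o iota
   that kills the monomials not of the form sigma^k (iota w). *)
Definition unplaces k (p : Defs.polyP K n) (f : polyF K n) : Prop :=
  forall w, coefF f w = coefP p (place k w).

Lemma unplaces_nil k : unplaces k [::] [::].
Proof. by move=> w; rewrite !coef_nil. Qed.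

Lemma unplaces_add k p q f g :
  unplaces k p f -> unplaces k q g -> unplaces k (fadd p q) (fadd f g).
Proof. by move=> pf qg w; rewrite !coef_add pf qg. Qed.

Lemma unplaces_scale k c p f : unplaces k p f -> unplaces k (fscale c p) (fscale c f).
Proof. by move=> pf w; rewrite !coef_scale pf. Qed.

Lemma unplaces_feq k p q f : feqP p q -> unplaces k p f -> unplaces k q f.
Proof. by move=> pq pf w; rewrite pf pq. Qed.

Lemma coef_mul_mono p m x :
  coefP (fmulP p (monof K m)) x = \sum_(t <- p) t.1 * (perm_eq (t.2 ++ m) x)%:R.
Proof. by rewrite coef_flin fmul_term /flin big_map; apply: eq_bigr => t _; rewrite mulr1. Qed.

Lemma feq_mul_term_mono p c m' m : feqP (fmulP (fmulP p [:: (c, m')]) (monof K m))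
  (fscale c (fmulP p (monof K (m' ++ m)))).
Proof.
move=> x; rewrite (feq_term_assoc GP) coef_scale coef_mul_mono /= mulr1.
rewrite coef_flin fmul_term /flin big_map mulr_sumr; apply: eq_bigr => t _ /=.
by rewrite mulrA [c * _]mulrC.
Qed.

Lemma feq_term_mul_mono p c m' m : feqP (fmulP (fmulP [:: (c, m')] p) (monof K m))
  (fscale c (fmulP p (monof K (m' ++ m)))).
Proof.
move=> x; rewrite coef_scale !coef_mul_mono fmul_term_l big_map mulr_sumr.
apply: eq_bigr => t _ /=; rewrite mulrA; congr (_ * _%:R).
suff /permPl -> : perm_eq (mmulP m' t.2 ++ m) (t.2 ++ m' ++ m) by [].
by rewrite /mmulP -catA perm_catCA.
Qed.

Lemma fmul_add_l (p q a : Defs.polyP K n) : fmulP (fadd p q) a = fadd (fmulP p a) (fmulP q a).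
Proof. exact: allpairs_cat. Qed.

Lemma unplaces_ideal k l f m : I f ->
  exists2 g, I g & unplaces l (fmulP (placef k f) (monof K m)) g.
Proof.
move=> If.
(* Viewing f as a vector of rank one with shift zero lets [vcomp_sum_ind] reduce to homogeneous
   f. *)
pose N (v : vecF K n 1) := exists2 g, I g &
  unplaces l (fmulP (placef k (v ord0)) (monof K m)) g.
suff : N (fun=> f) by [].
apply: (vcomp_sum_ind GF (delta := fun=> 0%N)) => [v w vw [g Ig gv]||v w [g Ig gv] [h Ih hw]|d].
- exists g => //; apply: unplaces_feq gv; apply: (feq_mull GP).
  exact: feq_placef.
- by exists [::]; [exact: id_0 idI | exact: unplaces_nil].
- exists (fadd g h); first exact: (id_add idI).
  rewrite /vadd /placef /fadd map_cat.
  by rewrite [fmulP _ _]fmul_add_l; apply: unplaces_add.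
rewrite /N /vcomp /= subn0; set fd := fhomog _ d f.
have Ifd : I fd by apply: (proj2 grI).
have szd t : t \in fd -> size t.2 = d by rewrite mem_filter => /andP[/eqP].
(* Whether m completes a block of length d at place k depends on d alone. If it does, the same a and
   b serve every term of fd; otherwise every term is killed. *)
have [[u [w [su h]]]|none] := pselect (exists u w, size u = d /\
    perm_eq (place k u ++ m) (place l w)).
  have [a [b ab]] := place_block h; rewrite su in ab.
  exists (fmulF (monof K a) (fmulF fd (monof K b))).
    by apply: (id_mull idI); apply: (id_mulr idI).
  move=> w'; rewrite coef_mul_mono coef_flin fmul_term_l fmul_term /flin !big_map.
  apply: eq_big_seq => t /szd st /=; rewrite mulr1 mul1r; congr (_ * _%:R).
  by rewrite (permPl (ab _ st)) eq_place.
exists [::]; first exact: id_0 idI.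
move=> w; rewrite coef_nil coef_mul_mono big_map big1_seq // => t /= /szd st.
case h: (perm_eq _ _); rewrite ?mulr0 //.
by case: none; exists t.2, w.
Qed.

(** Quantifying over the monomial m makes the property stable under multiplication: a further term
    is absorbed into m and a scalar. A multiple of a generator of Q repeats a place, which no
    [place l w] does, so its image is zero. *)
Lemma unplaces_ZS z : ZS I z -> forall l m,
  exists2 g, I g & unplaces l (fmulP z (monof K m)) g.
Proof.
pose N z := forall l m, exists2 g, I g & unplaces l (fmulP z (monof K m)) g.
move=> Zz; suff : N z by [].
have Nscale (p q : Defs.polyP K n) c m' :
    (forall m, feqP (fmulP q (monof K m)) (fscale c (fmulP p (monof K (m' ++ m))))) ->
    N p -> N q.
  move=> qp Np l m; have [g Ig gp] := Np l (m' ++ m).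
  exists (fscale c g); first exact: (ideal_scale GF).
  by apply: unplaces_feq (unplaces_scale c gp) => x; rewrite qp.
apply: Zz => [|x].
  apply: (ideal_by_terms (meq := @meqP n)) => [p q pq Np l m|l m|p q Np Nq l m|[c m'] p Np|p [c m'] Np].
  - have [g Ig gp] := Np l m; exists g => //.
    by apply: unplaces_feq gp; apply: (feq_mull GP).
  - by exists [::]; [exact: id_0 idI | exact: unplaces_nil].
  - have [[g Ig gp] [h Ih hq]] := (Np l m, Nq l m).
    exists (fadd g h); first exact: (id_add idI).
    by rewrite fmul_add_l; apply: unplaces_add.
  - exact: Nscale (feq_term_mul_mono p c m') Np.
  - exact: Nscale (feq_mul_term_mono p c m') Np.
move=> [[i [j [k ->]]]|[f [k [If ->]]]] l m; last first.
  by rewrite iter_sigma_iotaF; apply: unplaces_ideal.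
exists [::]; first exact: id_0 idI.
move=> w; rewrite coef_nil coef_mul_mono big_seq1 /=.
case h: (perm_eq _ _); rewrite ?mulr0 //.
have := perm_uniq (perm_map snd h).
by rewrite places_place iota_uniq /= inE eqxx.
Qed.

(** * The letterplace map on graded free modules *)

Section IotaModule.
Context (r : nat) (delta : 'I_r -> nat).
Local Notation genA := (@gen K _ (@meqF n) (@mmulF n) r I).
Local Notation genS := (@gen K _ (@meqP n) (@mmulP n) r (ZS I)).
Local Notation submodA := (@is_submod K _ (@meqF n) (@mmulF n) r I).
Local Notation submodS := (@is_submod K _ (@meqP n) (@mmulP n) r (ZS I)).
Local Notation vfeqF := (@vfeq K _ (@meqF n) r).
Local Notation vfeqP := (@vfeq K _ (@meqP n) r).
Local Notation vcompF := (@vcomp K _ (@mdegF n) r delta).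
Local Notation vcompP := (@vcomp K _ (@mdegP n) r delta).
Local Notation iotaV := (@iotaV K n r delta).

Definition iota_set (N : vecF K n r -> Prop) (x : vecP K n r) : Prop :=
  exists v, N v /\ x = iotaV v.

Lemma iotaVE v i : iotaV v i = placef (delta i) (v i).
Proof. exact: iter_sigma_iotaF. Qed.

Lemma iotaV_feq v w : vfeqF v w -> vfeqP (iotaV v) (iotaV w).
Proof. by move=> vw i; rewrite !iotaVE; apply: feq_placef. Qed.

Lemma iotaV_add v w : vfeqP (iotaV (vadd v w)) (vadd (iotaV v) (iotaV w)).
Proof. by move=> i m; rewrite /vadd /fadd !iotaVE /placef map_cat. Qed.

Lemma iotaV_sub v w : vfeqP (iotaV (vsub v w)) (vsub (iotaV v) (iotaV w)).
Proof.
move=> i m; rewrite /vsub /fadd !iotaVE /placef map_cat /fopp /fscale -!map_comp.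
by [].
Qed.

Lemma iotaV_qzero v : qzero I v -> qzero (ZS I) (iotaV v).
Proof. by move=> Iv i; rewrite iotaVE; apply: ZS_placef. Qed.

Lemma iotaV_vcomp d v : vfeqP (vcompP d (iotaV v)) (iotaV (vcompF d v)).
Proof.
move=> i m; rewrite iotaVE /vcomp iotaVE; case: ifP => // _.
by rewrite homog_placef.
Qed.

Lemma iotaV_homog d v : homogA I delta d v -> homogS I delta d (iotaV v).
Proof.
move=> hv; exists (vcompP d (iotaV v)); split; last exact: (vcomp_lhomog GP).
apply: (qzero_feq ZS_graded) (iotaV_qzero (qhomog_vcomp GF grI hv)) => i m.
by rewrite iotaV_sub !coef_vsub iotaV_vcomp.
Qed.

(** In the component of degree d, the words in coordinate i start at place [delta i] and end just
    before place d. So m must be [place d b], with one word b for all coordinates, and the image is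
    that component times b. *)
Lemma unplaces_submod N m v : submodA N -> (forall u d, N u -> N (vcompF d u)) -> N v ->
  exists2 f, N f & forall i, unplaces (delta i) (fmulP (iotaV v i) (monof K m)) (f i).
Proof.
move=> smN grN Nv.
pose T u := exists2 f, N f & forall i, unplaces (delta i) (fmulP (iotaV u i) (monof K m)) (f i).
suff : T v by [].
apply: (vcomp_sum_ind GF (delta := delta)) => [u w uw [f Nf fu]||u w [f Nf fu] [g Ng gw]|d].
- exists f => // i; apply: unplaces_feq (fu i); apply: (feq_mull GP).
  exact: iotaV_feq.
- exists (@vnil K (MonF n) r); first exact: (submod_vnil grI smN).
  by move=> i; rewrite iotaVE; apply: unplaces_nil.
- exists (vadd f g); first exact: (sm_add smN).
  move=> i; rewrite iotaVE /vadd {1}/fadd /placef map_cat.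
  rewrite [fmulP _ _]fmul_add_l; apply: unplaces_add.
    by have := fu i; rewrite iotaVE.
  by have := gw i; rewrite iotaVE.
have szd i t : t \in vcompF d v i -> (delta i + size t.2 = d)%N.
  rewrite /vcomp; case: ifP => // di; rewrite mem_filter /mdegF => /andP[/eqP -> _].
  by rewrite subnKC.
have [[b mb]|none] := pselect (exists b, perm_eq m (place d b)).
  exists (vmulr (@mmulF n) (vcompF d v) (monof K b)).
    by apply: (sm_mulr smN); apply: grN.
  move=> i w; rewrite iotaVE coef_mul_mono /vmulr coef_flin fmul_term /flin !big_map.
  apply: eq_big_seq => t /szd st /=; rewrite mulr1; congr (_ * _%:R).
  by rewrite (permPl (perm_cat (perm_refl _) mb)) -st -place_cat eq_place.
exists (@vnil K (MonF n) r); first exact: (submod_vnil grI smN).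
move=> i w; rewrite coef_nil iotaVE coef_mul_mono big_map big1_seq // => t /= /szd st.
case h: (perm_eq _ _); rewrite ?mulr0 //; have [b _ mb] := place_prefix h.
by case: none; exists b; rewrite -st.
Qed.

(** The vectors whose product with any monomial is mapped into N by the left inverse form an
    S-submodule containing the image of N. Taking the monomial 1 at the image of v gives back v. *)
Lemma iotaV_gen_reflect N v : is_graded_submod (@meqF n) (@mmulF n) (@mdegF n) delta I N ->
  genS (iota_set N) (iotaV v) -> N v.
Proof.
move=> [smN grN] Sv.
pose T x := forall m, exists2 f, N f &
  forall i, unplaces (delta i) (fmulP (x i) (monof K m)) (f i).
have : T (iotaV v).
  apply: Sv => [|_ [w [Nw ->]] m]; last exact: unplaces_submod.
  apply: (submod_by_terms ZS_graded) => [x y xy Tx m|x Zx m|x y Tx Ty m|x [c m'] Tx m].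
  - have [f Nf fx] := Tx m; exists f => // i.
    by apply: unplaces_feq (fx i); apply: (feq_mull GP).
  (* Coordinates are unplaced independently; all results lie in I, so the vector is zero over A and
     belongs to N. *)
  - have [f fx] := choice (fun i => (exists2P _ _).1 (unplaces_ZS (Zx i) (delta i) m)).
    by exists f => [|i]; [apply: (sm_zero smN) => i|]; have [] := fx i.
  - have [[f Nf fx] [g Ng gy]] := (Tx m, Ty m); exists (vadd f g); first exact: (sm_add smN).
    by move=> i; rewrite fmul_add_l; apply: unplaces_add.
  - have [f Nf fx] := Tx (m' ++ m); exists (vscale c f); first exact: (submod_scale GF c smN Nf).
    move=> i; apply: unplaces_feq (unplaces_scale c (fx i)) => z.
    by rewrite feq_mul_term_mono.
move=> /(_ [::])[f Nf fv]; apply: (sm_feq smN) Nf => i w.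
by rewrite fv (feq_mul1 GP) iotaVE coef_placef.
Qed.

Lemma iotaV_mul_term e v c u : vfeqP (iotaV (vmulr (@mmulF n) (vcompF e v) [:: (c, u)]))
  (vmulr (@mmulP n) (iotaV (vcompF e v)) [:: (c, place e u)]).
Proof.
move=> i m; rewrite /vmulr !iotaVE !fmul_term /placef -!map_comp.
congr (coef _ _ _); apply/eq_in_map => t /=.
rewrite /vcomp; case: ifP => // de; rewrite mem_filter /mdegF => /andP[/eqP st _].
by rewrite /mmulF /mmulP place_cat st subnKC.
Qed.

(** The map is compatible with multiplication only on homogeneous vectors, where the place of the
    new word is determined by the degree. The induction therefore follows all components of v. *)
Lemma iotaV_gen (X : vecF K n r -> Prop) v : (forall x, X x -> exists d, homogA I delta d x) ->
  genA X v -> genS (iota_set X) (iotaV v).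
Proof.
move=> Xh Xv; set G := genS _.
have smG : submodS G by apply: gen_submod.
have grG : is_graded_submod (@meqP n) (@mmulP n) (@mdegP n) delta (ZS I) G.
  apply: (gen_graded GP ZS_graded) => _ [x [Xx ->]].
  by have [d hx] := Xh x Xx; exists d; apply: iotaV_homog.
suff Gd : forall d, G (iotaV (vcompF d v)).
  apply: (vcomp_sum_ind GF (N := fun u => G (iotaV u)) _ _ _ Gd) => [u w uw Gu||u w Gu Gw].
  - exact: (sm_feq smG) (iotaV_feq uw) Gu.
  - by apply: (sm_zero smG); apply: iotaV_qzero => i; apply: id_0 idI.
  - by apply: (sm_feq smG) (sm_add smG Gu Gw) => i m; rewrite iotaV_add.
apply: (Xv (fun u => forall d, G (iotaV (vcompF d u)))) => [|x Xx d]; last first.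
  apply: (sm_feq smG) (iotaV_vcomp d x) _; apply: (proj2 grG).
  by apply: gen_in; exists x.
apply: (submod_by_terms grI) => [u w uw Gu d|u Iu d|u w Gu Gw d|u [c x] Gu d].
- apply: (sm_feq smG) (iotaV_feq _) (Gu d); exact: (vcomp_feq GF).
- exact: (sm_zero smG (iotaV_qzero (qzero_vcomp delta grI d Iu))).
- apply: (sm_feq smG) (sm_add smG (Gu d) (Gw d)) => i m.
  rewrite -(iotaV_add _ _ i m); apply: iotaV_feq => j z.
  by rewrite (coef_vadd, coef_vcomp GF) !(coef_vcomp GF) coef_vadd; case: ifP; rewrite ?addr0.
have E := iotaV_feq (vcomp_term GF delta d u (c, x)).
apply: (sm_feq smG) (fun i m => esym (E i m)) _ => /=; case: ifP => _; last first.
  by apply: (sm_zero smG); apply: iotaV_qzero => i; apply: id_0 idI.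
apply: (sm_feq smG) (fun i m => esym (iotaV_mul_term _ _ _ _ i m)) _.
exact: (sm_mulr smG).
Qed.

Context (M : vecF K n r -> Prop).

(** With P always true this compares bases; with P excluding one index it compares the irredundancy
    conditions. *)
Lemma gen_iotaV (J : Type) (g : J -> vecF K n r) (P : J -> Prop) v :
  (forall j, exists d, homogA I delta d (g j)) ->
  genA (fun x => exists2 j, P j & x = g j) v <->
  genS (fun x => exists2 j, P j & x = iotaV (g j)) (iotaV v).
Proof.
move=> gh; split=> [gv|Gv].
  apply: gen_sub (iotaV_gen _ gv) => [_ [x [[j Pj ->] ->]]|_ [j _ ->]]; last exact: gh.
  by apply: gen_in; exists j.
apply: iotaV_gen_reflect.
  by apply: (gen_graded GF grI) => _ [j _ ->]; apply: gh.
apply: gen_sub Gv => _ [j Pj ->]; apply: gen_in; exists (g j); split=> //.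
by apply: gen_in; exists j.
Qed.

Lemma basis_iotaV (J : Type) (g : J -> vecF K n r) :
  (forall j, M (g j)) -> (forall j, exists d, homogA I delta d (g j)) ->
  basisA I delta M g <-> basisS I delta (Lmod I delta M) (fun j => iotaV (g j)).
Proof.
move=> Mg gh.
have genE v : genA (fun x => exists j, x = g j) v <->
    genS (fun x => exists j, x = iotaV (g j)) (iotaV v).
  have [gG Gg] := gen_iotaV (fun=> True) v gh.
  split=> [gv|Gv]; [apply: gen_sub (gG _)|apply: gen_sub (Gg _)].
  - by move=> _ [j _ ->]; apply: gen_in; exists j.
  - by apply: gen_sub gv => _ [j ->]; apply: gen_in; exists j.
  - by move=> _ [j _ ->]; apply: gen_in; exists j.
  - by apply: gen_sub Gv => _ [j ->]; apply: gen_in; exists j.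
split=> [[_ _ gM]|[_ _ GM]]; split=> //.
- by move=> j; apply: gen_in; exists (g j).
- by move=> j; have [d hd] := gh j; exists d; apply: iotaV_homog.
- move=> x Lx; apply: gen_sub Lx => _ [v [Mv ->]]; exact: (genE v).1 (gM v Mv).
- move=> v Mv; apply: (genE v).2; apply: GM; apply: gen_in; by exists v.
Qed.

Lemma min_basis_iotaV (J : Type) (g : J -> vecF K n r) :
  (forall j, M (g j)) -> (forall j, exists d, homogA I delta d (g j)) ->
  min_basisA I delta M g <-> min_basisS I delta (Lmod I delta M) (fun j => iotaV (g j)).
Proof.
move=> Mg gh; have [gG Gg] := basis_iotaV Mg gh.
split=> -[b irr]; split=> [|j gj]; try by [apply: gG|apply: Gg].
  by apply: (irr j); apply: (gen_iotaV (fun k => k <> j) (g j) gh).2.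
by apply: (irr j); apply: (gen_iotaV (fun k => k <> j) (g j) gh).1.
Qed.

(** Basis elements of degree d are linearly independent modulo zero, and each is a combination of
    the vectors given by a coordinate and a word of length at most d. Words of bounded length are
    used because the exact length varies with [delta i]. *)
Lemma min_basisA_homog_bound (J : Type) (h : J -> vecF K n r) d m (y : 'I_m -> J) :
  min_basisA I delta M h -> injective y -> (forall i, homogA I delta d (h (y i))) ->
  (m <= #|{: 'I_r * d.-bseq 'I_n}|)%N.
Proof.
move=> [_ irr] yinj hd.
pose word l : 'I_r * d.-bseq 'I_n := enum_val (A := {: 'I_r * d.-bseq 'I_n}) l.
pose u l : vecF K n r := fun i => if (word l).1 == i then [:: (1, bseqval (word l).2)] else [::].
pose C i l := coefF (vcompF d (h (y i)) (word l).1) (word l).2.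
have smI : submodA (qzero I) by apply: qzero_submod grI.
apply: (irredundant_bound GF grI (u := u) (C := C) irr yinj smI) => [i v Iv|i].
  by move=> N smN _; apply: (sm_zero smN Iv).
apply: (qzero_feq grI) (qhomog_vcomp GF grI (hd i)) => j w.
rewrite !coef_vsub coef_vlin; congr (_ - _).
under eq_bigr => l _.
  rewrite (_ : coefF (u l j) w = ((word l).1 == j)%:R * (bseqval (word l).2 == w)%:R); last first.
    rewrite /u; case: eqP => _; last by rewrite coef_nil mul0r.
    by rewrite coef_fcons coef_nil addr0.
  over.
(* A word longer than d occurs neither in a component of degree d nor among the spanning vectors. *)
have [sw|sw] := leqP (size w) d; last first.
  rewrite (coef_vcomp GF) ifF; last by rewrite /mdegF; lia.
  rewrite big1 // => l _; rewrite (_ : (_ == w) = false) ?mulr0 //.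
  by apply/eqP => wE; have := size_bseq (word l).2; rewrite wE; lia.
rewrite (bigD1 (enum_rank (j, Bseq sw))) //= big1 ?addr0 => [|l].
  by rewrite /C /word enum_rankK !eqxx !mulr1.
rewrite -(inj_eq enum_val_inj) enum_rankK => ne.
have [E1|] := eqVneq (word l).1 j; last by rewrite mul0r mulr0.
have [E2|] := eqVneq (bseqval (word l).2) w; last by rewrite !mulr0.
case/eqP: ne; apply/eqP; rewrite -[enum_val l]/(word l).
by case: (word l) E1 E2 => a b /= -> bw; apply/eqP; congr pair; apply: val_inj.
Qed.

End IotaModule.
End Iota.

(** * Finite enumerations and equality of Betti numbers *)

Lemma bounded_enum (T : Type) k :
  (forall m (y : 'I_m -> T), injective y -> (m <= k)%N) ->
  exists m (y : 'I_m -> T), injective y /\ forall t, exists i, y i = t.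
Proof.
move=> le_k; pose P m := `[< exists y : 'I_m -> T, injective y >].
have exP : exists m, P m.
  by exists 0%N; apply/asboolP; exists (fun i : 'I_0 => False_rect T (notF (ltn_ord i))) => -[].
have leP m : P m -> (m <= k)%N by move=> /asboolP[y]; apply: le_k.
(* An injection of maximal size is onto, since a missed element t could be added as the value at
   [ord_max]. *)
case: (ex_maxnP exP leP) => m /asboolP[y yinj] maxm; exists m, y; split=> // t.
apply: contrapT => tN; suff /maxm : P m.+1 by rewrite ltnn.
apply/asboolP; exists (fun i => if unlift ord_max i is Some j then y j else t).
move=> i j; case: unliftP => [i' ->|->]; case: unliftP => [j' ->|->] //.
- by move=> /yinj ->.
- by move=> e; case: tN; exists i'.
- by move=> e; case: tN; exists j'.
Qed.

Lemma sval_injective (T : Type) (P : T -> Prop) : injective (@sval T P).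
Proof.
move=> [x p] [y q] /= e; rewrite e in p *.
by congr exist; apply: Prop_irrelevance.
Qed.

Theorem mainTheorem10 (K : fieldType) (n r : nat) (I : polyF K n -> Prop)
  (delta : 'I_r -> nat) (M : vecF K n r -> Prop) (J : Type) (g : J -> vecF K n r) :
  is_graded_ideal (@meqF n) (@mmulF n) (@mdegF n) I ->
  is_graded_submod (@meqF n) (@mmulF n) (@mdegF n) delta I M ->
  (forall j, M (g j)) ->
  (forall j, exists d, homogA I delta d (g j)) ->
  (basisA I delta M g <-> basisS I delta (Lmod I delta M) (fun j => iotaV delta (g j)))
  /\ (min_basisA I delta M g <->
      min_basisS I delta (Lmod I delta M) (fun j => iotaV delta (g j)))
  /\ (forall (J1 J2 : Type) (h1 : J1 -> vecF K n r) (h2 : J2 -> vecP K n r),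
        min_basisA I delta M h1 -> min_basisS I delta (Lmod I delta M) h2 ->
        forall d : nat,
        exists (f : {j : J1 | homogA I delta d (h1 j)} -> {k : J2 | homogS I delta d (h2 k)})
               (f' : {k : J2 | homogS I delta d (h2 k)} -> {j : J1 | homogA I delta d (h1 j)}),
          cancel f f' /\ cancel f' f).
Proof.
move=> grI _ Mg gh; split; first exact: basis_iotaV.
split; first exact: min_basis_iotaV.
move=> J1 J2 h1 h2 minA min2 d.
have [[Mh1 hh1 _] _] := minA.
have min1 := (min_basis_iotaV grI Mh1 hh1).1 minA.
have GP := commutative_graded_monoid n; have grS := ZS_graded grI.
(* The image of [h1 j] belongs to a minimal basis of L(M), so its degree is unique and equals the
   degree e of [h1 j]. *)
have homE j : homogS I delta d (iotaV delta (h1 j)) -> homogA I delta d (h1 j).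
  have [e he] := hh1 j => hd.
  by rewrite (min_basis_degree_unique GP grS min1 hd (iotaV_homog grI he)).
have bound1 m (y : 'I_m -> {j : J1 | homogA I delta d (h1 j)}) :
    injective y -> (m <= #|{: 'I_r * d.-bseq 'I_n}|)%N.
  move=> yinj; apply: (min_basisA_homog_bound grI minA (y := sval \o y)).
    exact: inj_comp (@sval_injective _ _) yinj.
  by move=> i; exact: (svalP (y i)).
have [k1 [y1 [inj1 sur1]]] := bounded_enum bound1.
(* Comparing the two minimal bases of L(M) bounds the degree-d part of [h2] by k1, which also makes
   it finite. *)
have le12 m (y : 'I_m -> {k : J2 | homogS I delta d (h2 k)}) : injective y -> (m <= k1)%N.
  move=> yinj.
  apply: (min_basis_card_le GP grS (d := d) (x := sval \o y1) (y := sval \o y) min1 min2).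
  - by move=> j /homE hj; have [l yl] := sur1 (exist _ j hj); exists l; rewrite /= yl.
  - exact: inj_comp (@sval_injective _ _) yinj.
  - by move=> i; exact: (svalP (y i)).
have [k2 [y2 [inj2 sur2]]] := bounded_enum le12.
have k21 : (k1 <= k2)%N.
  apply: (min_basis_card_le GP grS (d := d) (x := sval \o y2) (y := sval \o y1) min2 min1).
  - by move=> j hj; have [l yl] := sur2 (exist _ j hj); exists l; rewrite /= yl.
  - exact: inj_comp (@sval_injective _ _) inj1.
  - by move=> i; apply: (iotaV_homog grI); exact: (svalP (y1 i)).
have ek : k1 = k2 by apply/eqP; rewrite eqn_leq k21 (le12 _ _ inj2).
case: _ / ek in y2 inj2 sur2 k21 *.
(* Both degree-d parts are enumerated by the same ['I_k1]; the bijection passes through these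
   indices. *)
have [[f1 f1K] [f2 f2K]] := (choice sur1, choice sur2).
exists (y2 \o f1), (y1 \o f2); split=> t /=.
  by rewrite (inj2 _ _ (f2K _)) f1K.
by rewrite (inj1 _ _ (f1K _)) f2K.
Qed.
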